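(* Let $A$ be an $n\times n$ nonsingular irreducible stochastic matrix with $|\mathcal P_+(A)|=\infty$, and let $L\in\mathcal L_+(A)$. Then $L$ is permutationally similar to $\bigoplus_{i=1}^{t} C_{n_i}$ for some $n_i\in\mathbb N$, where $\sum_{i=1}^t n_i=n$ and $t$ is the multiplicity of $1$ in the spectrum of $L$.
   Context: $\mathbb N=\{1,2,3,\dots\}$. A stochastic matrix is an entrywise nonnegative real square matrix with every row sum equal to $1$. For an $n\times n$ stochastic matrix $A$: $\mathcal P_+(A):=\{c\in\mathbb N : B^c=A \text{ for some } n\times n\text{ stochastic matrix } B\}$; and $\mathcal L_+(A)$ is the set of all matrices $L$ for which there exist a strictly increasing sequence $(c_i)_{i\ge1}$ of positive integers and a convergent sequence $(B_i)_{i\ge 1}$ of $n\times n$ stochastic matrices with $B_i^{c_i}=A$ for all $i$ and $\lim_{i\to\infty}B_i=L$. $C_m$ is the $m\times m$ adjacency matrix of the directed cycle $1\to2\to\cdots\to m\to1$ (so $C_1=(1)$). Two matrices $X,Y$ are permutationally similar if $Y=P^\top XP$ for some permutation matrix $P$. *)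

(* Defs.v *)
From mathcomp Require Import all_boot all_order all_fingroup all_algebra.
From mathcomp Require Import all_classical all_reals topology normedtype.
From mathcomp Require Import sequences.

Set Implicit Arguments.
Unset Strict Implicit.
Unset Printing Implicit Defensive.

Import Order.TTheory GRing.Theory Num.Theory.
Import numFieldNormedType.Exports.

Local Open Scope classical_set_scope.
Local Open Scope ring_scope.

Definition stochastic_mx (R : realType) (n : nat) (A : 'M[R]_n) : Prop :=
  (forall i j, 0 <= A i j) /\ (forall i, \sum_j A i j = 1).

Definition perm_similar (R : realType) (n : nat) (X Y : 'M[R]_n) : Prop :=
  exists2 P : 'M[R]_n, is_perm_mx P & Y = P^T *m X *m P.

(* Not permutationally similar to a block upper triangular matrix whose two
   diagonal blocks, of orders k and n - k, are both nonempty.  In particular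
   every matrix of order 1 is irreducible. *)
Definition irreducible_mx (R : realType) (n : nat) (A : 'M[R]_n) : Prop :=
  ~ exists (Y : 'M[R]_n) (k : nat),
      [/\ perm_similar A Y, (0 < k < n)%N &
          forall i j : 'I_n, (k <= i)%N -> (j < k)%N -> Y i j = 0].

Definition root_exponents (R : realType) (n : nat) (A : 'M[R]_n) : set nat :=
  [set c | (0 < c)%N /\
           exists2 B : 'M[R]_n, stochastic_mx B & B ^+ c = A].

(* The sequences are indexed from 0 rather than from 1; the topology on
   matrices is that of entrywise convergence. *)
Definition root_limits (R : realType) (n : nat) (A : 'M[R]_n) : set 'M[R]_n :=
  [set L | exists (c : nat -> nat) (B : nat -> 'M[R]_n),
     [/\ forall i, (0 < c i)%N,
         {homo c : i j / (i < j)%N},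
         forall i, stochastic_mx (B i),
         forall i, B i ^+ c i = A &
         B i @[i --> \oo] --> L]].

Definition cycle_mx (R : realType) (m : nat) : 'M[R]_m :=
  \matrix_(i, j) (j == (i.+1 %% m)%N :> nat)%:R.

(* Main.v *)
Require Import Defs.
From mathcomp Require Import all_boot all_order all_fingroup all_algebra.
From mathcomp Require Import all_classical all_reals topology normedtype.
From mathcomp Require Import sequences.

Set Implicit Arguments.
Unset Strict Implicit.
Unset Printing Implicit Defensive.

Import Order.TTheory GRing.Theory Num.Theory.
Import numFieldNormedType.Exports.

Local Open Scope classical_set_scope.
Local Open Scope ring_scope.

(** The whole argument rests on the determinant.  From [B_i ^ c_i = A] follows
[|det B_i| ^ c_i = |det A|], where [|det A|] is a fixed positive number and
[c_i] tends to infinity; so [|det B_i|] cannot stay below a constant [q < 1],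
and the limit [L] satisfies [|det L| >= 1] ([root_limits_normdet_ge1]).  As the
stochastic matrices form a closed set, [L] is stochastic as well.

A stochastic matrix with [|det L| >= 1] is a permutation matrix
([stochastic_normdet_ge1_perm]).  Indeed, the product of its row sums, which is
[1], expands as the sum of the nonnegative weights [\prod_i L i (f i)] over all
self-maps [f] of the index set, and the Leibniz formula bounds [|det L|] by the
part of this sum that comes from the bijections.  Hence every map that is not
injective has weight [0].  Starting from a permutation of nonzero weight and
changing its value at one point gives such a map, so no row of [L] can have a
second nonzero entry.

It remains to sort the indices along the cycles of the permutation, which turns
[L] into a direct sum of cyclic matrices ([perm_mx_similar_cycles]).  The
characteristic polynomial is then the product of the ['X^(m_i) - 1], each of
which has [1] as a simple root; so the number of cycles is the multiplicity
of the eigenvalue [1]. *)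

(** * Permutation matrices among stochastic matrices *)

Lemma sum_perm_ffun (V : nmodType) (T : finType) (F : {ffun T -> T} -> V) :
  \sum_(s : {perm T}) F (pval s) = \sum_(f : {ffun T -> T} | injectiveb f) F f.
Proof.
rewrite [RHS](reindex (@pval _)) /=.
  by apply: eq_big => // s; rewrite (valP s).
exists (insubd (1%g : {perm T})) => /= f inj_f; last exact: insubdK.
by apply: val_inj; apply: insubdK.
Qed.

(** Expanding the product of the row sums over all self-maps leaves no weight
for the maps that are not injective, because the bijections already account
for [|det L|]. *)
Lemma stochastic_normdet_ge1_perm (R : realType) n (L : 'M[R]_n) :
  stochastic_mx L -> 1 <= `|\det L| -> is_perm_mx L.
Proof.
move=> [L_ge0 rowL] detL.
pose w (f : {ffun 'I_n -> 'I_n}) := \prod_i L i (f i).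
have w_ge0 f : 0 <= w f by apply: prodr_ge0.
have sum_w : \sum_f w f = 1.
  by rewrite /w -(bigA_distr_bigA (fun i j => L i j)) big1.
have detL_le : `|\det L| <= \sum_(s : 'S_n) w (pval s).
  rewrite (le_trans (ler_norm_sum _ _ _))// ler_sum// => s _.
  rewrite normrM normrX normrN1 expr1n mul1r ger0_norm ?prodr_ge0//.
  by under eq_bigr do rewrite -pvalE.
have inj_ge1 : 1 <= \sum_(f : {ffun 'I_n -> 'I_n} | injectiveb f) w f.
  by rewrite -(sum_perm_ffun w) (le_trans detL).
have w_noninj (f : {ffun 'I_n -> 'I_n}) : ~~ injectiveb f -> w f = 0.
  move=> noninj_f; apply/eqP; rewrite eq_le w_ge0 andbT.
  move: sum_w.
  rewrite (bigID (fun f : {ffun _ -> _} => injectiveb f)) /= => sum_w.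
  have rest_le0 : \sum_(f : {ffun 'I_n -> 'I_n} | ~~ injectiveb f) w f <= 0.
    by move: inj_ge1; rewrite -[X in X <= _]sum_w gerDl.
  rewrite (le_trans _ rest_le0)// (bigD1 f)//= lerDl.
  by apply: sumr_ge0.
have [s ws_gt0] : exists s : 'S_n, 0 < w (pval s).
  apply/existsP; apply: contraLR detL => /existsPn no_s.
  rewrite -ltNge (le_lt_trans detL_le)// big1 ?ltr01// => s _.
  by apply/eqP; rewrite eq_le w_ge0 andbT leNgt no_s.
have L_s_neq0 i : L i (s i) != 0.
  by move: ws_gt0; rewrite lt0r prodf_seq_neq0 => /andP[/allP/(_ i)];
    rewrite mem_index_enum -pvalE => /(_ isT).
have L_off i j : j != s i -> L i j = 0.
  move=> j_neq.
  pose f := [ffun k => if k == i then j else s k].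
  have /w_noninj/eqP : ~~ injectiveb f.
    (* The bijection s already takes the value j at another point than i. *)
    have sj_neq : (s^-1)%g j != i.
      by apply: contra_neq j_neq => <-; rewrite permKV.
    apply/injectivePn; exists i, ((s^-1)%g j) => //; first by rewrite eq_sym.
    by rewrite !ffunE eqxx (negPf sj_neq) permKV.
  rewrite prodf_seq_eq0 => /hasP[k _] /=; rewrite ffunE.
  by case: (eqVneq k i) => [-> /eqP //|_]; rewrite (negPf (L_s_neq0 k)).
apply/is_perm_mxP; exists s; apply/matrixP => i j; rewrite !mxE.
have [<-|si_neq] := eqVneq (s i) j; last by rewrite L_off // eq_sym.
by rewrite -(rowL i) (bigD1 (s i))//= big1 ?addr0 // => k; exact: L_off.
Qed.

(** * Limits of stochastic roots *)

Lemma det_expmx (R : comPzRingType) n (A : 'M[R]_n) c :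
  \det (A ^+ c) = \det A ^+ c.
Proof.
elim: c => [|c IHc]; first by rewrite !expr0 det1.
by rewrite !exprS -IHc -det_mulmx.
Qed.

Lemma cvg_det (R : realType) n (B : nat -> 'M[R]_n) (L : 'M[R]_n) :
  B i @[i --> \oo] --> L -> \det (B i) @[i --> \oo] --> \det L.
Proof.
move=> cvgB; apply: cvg_big; first exact: add_continuous.
move=> s _; apply: cvgM; first exact: cvg_cst.
apply: cvg_big; first exact: mul_continuous.
move=> i _; apply: (@cvg_comp _ _ _ B (fun M => M i (s i)) _ _ _ cvgB).
exact: coord_continuous.
Qed.

Lemma cvg_stochastic (R : realType) n (B : nat -> 'M[R]_n) (L : 'M[R]_n) :
  B i @[i --> \oo] --> L -> (forall i, stochastic_mx (B i)) -> stochastic_mx L.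
Proof.
move=> cvgB stochB.
have cvgBij i j : B k i j @[k --> \oo] --> L i j.
  apply: (@cvg_comp _ _ _ B (fun M => M i j) _ _ _ cvgB).
  exact: coord_continuous.
split=> i.
  move=> j; apply: (cvgr_to_ge (cvgBij i j)).
  by apply: nearW => k; have [+ _] := stochB k.
have cvg_row : \sum_j B k i j @[k --> \oo] --> \sum_j L i j.
  by apply: cvg_big => [|j _]; [exact: add_continuous|exact: cvgBij].
rewrite -(cvg_lim _ cvg_row)//.
under eq_fun do rewrite (stochB _).2.
exact: lim_cst.
Qed.

(** Otherwise [|det (B i)|] would eventually be below some [q < 1], and the
constant [|det A| = |det (B i)| ^ c i] below [q ^ i], which tends to [0]. *)
Lemma root_limits_normdet_ge1 (R : realType) n (A L : 'M[R]_n) :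
  A \in unitmx -> root_limits A L -> 1 <= `|\det L|.
Proof.
move=> unitA [c [B [_ incr_c _ BcA cvgB]]]; rewrite leNgt; apply/negP => detL.
have detA_gt0 : 0 < `|\det A| by rewrite normr_gt0 -unitfE.
have [q /andP[Lq q_lt1]] : exists q, `|\det L| < q < 1.
  by exists ((`|\det L| + 1) / 2); rewrite !midf_lt.
have q_ge0 : 0 <= q by rewrite (le_trans _ (ltW Lq)).
have le_c i : (i <= c i)%N.
  by elim: i => // i IHi; rewrite (leq_ltn_trans IHi)// incr_c.
have small_pow : \forall i \near \oo, `|q ^+ i| < `|\det A|.
  apply: (cvgr_norm_lt 0); last by rewrite normr0.
  by apply: cvg_expr; rewrite ger0_norm.
have small_det : \forall i \near \oo, `|\det (B i)| < q.
  exact: (cvgr_norm_lt (\det L) (cvg_det cvgB)).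
near \oo => i.
have /negP[] : ~~ (`|\det A| < `|\det A|) by rewrite ltxx.
rewrite -[X in X < _](_ : `|\det (B i)| ^+ c i = _); last first.
  by rewrite -normrX -det_expmx BcA.
apply: (@le_lt_trans _ _ `|q ^+ i|); last by near: i.
rewrite [`|q ^+ i|]ger0_norm ?exprn_ge0// (@le_trans _ _ (q ^+ c i))//.
  by apply: lerXn2r; rewrite ?nnegrE//; apply: ltW; near: i.
by rewrite ler_wiXn2l// ltW.
Unshelve. all: by end_near. Qed.

(** * Characteristic polynomials of direct sums of cycles *)

Lemma det_mxdiag (R : comPzRingType) t (m : 'I_t -> nat)
    (B : forall i, 'M[R]_(m i)) :
  \det (\mxdiag_i B i) = \prod_i \det (B i).
Proof.
elim: t => [|t IHt] in m B *.
  rewrite [RHS]big_ord0; move: (\mxdiag_i B i); rewrite big_ord0 => M.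
  exact: det_mx00.
rewrite mxdiag_recl [RHS]big_ord_recl /= -IHt.
by case: _ / mxsize_recl; rewrite castmx_id det_ublock.
Qed.

Lemma char_poly_mxdiag (R : comNzRingType) t (m : 'I_t -> nat)
    (B : forall i, 'M[R]_(m i)) :
  char_poly (\mxdiag_i B i) = \prod_i char_poly (B i).
Proof.
rewrite -det_mxdiag /char_poly; congr (\det _).
rewrite mxdiagB mxdiagZ; congr (_ - _); apply/matrixP => i j; rewrite !mxE.
by case: eqVneq => _; rewrite ?mxE// -(map_mx0 polyC) -map_conform_mx mxE.
Qed.

Lemma char_poly_castmx (R : nzRingType) n n' (e : n = n') (A : 'M[R]_n) :
  char_poly (castmx (e, e) A) = char_poly A.
Proof. by case: _ / e; rewrite castmx_id. Qed.

(** The matrix of a directed cycle is the companion matrix of ['X^m - 1]; its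
last row carries the negated coefficients of this polynomial, that is, a single
[1] in the first column. *)
Lemma char_poly_cycle_mx (R : realType) k :
  char_poly (cycle_mx R k.+1) = 'X^(k.+1) - 1.
Proof.
have monic_p : 'X^(k.+1) - 1 \is @monic R by rewrite -polyC1 monicXnsubC.
have size_p : (size ('X^(k.+1) - 1 : {poly R})).-1 = k.+1.
  by rewrite -polyC1 size_XnsubC.
rewrite -[RHS](companionmxK monic_p).
rewrite -[RHS](char_poly_castmx size_p).
congr char_poly; apply/matrixP => i j.
rewrite castmxE !mxE /= size_p /= coefB coefXn coef1.
have [ik|ik] := eqVneq (i : nat) k.
  rewrite ik modnn (ltn_eqF (ltn_ord j)).
  by rewrite sub0r opprK.
rewrite modn_small; first by rewrite eq_sym.
by rewrite ltnS ltn_neqAle ik -ltnS ltn_ord.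
Qed.

Lemma mup_prod (F : fieldType) (I : finType) (x : F) (p : I -> {poly F}) :
  (forall i, p i != 0) -> mup x (\prod_i p i) = (\sum_i mup x (p i))%N.
Proof.
move=> p_neq0.
have [] // : \prod_i p i != 0 /\ mup x (\prod_i p i) = (\sum_i mup x (p i))%N.
apply: (big_rec2 (fun q d => q != 0 /\ mup x q = d)) => [|i d q _ [q0 <-]].
  by rewrite oner_eq0 mupNroot // root1.
by rewrite mulf_neq0// mupM.
Qed.

(** The cofactor [\sum_(i < k.+1) 'X^i] takes at [1] the value [k.+1], which is
nonzero in characteristic [0]. *)
Lemma mup1_Xnsub1 (F : numFieldType) k :
  mup 1 ('X^(k.+1) - 1 : {poly F}) = 1%N.
Proof.
rewrite subrX1 mupMl; first by rewrite -polyC1 -['X - _]expr1 mup_XsubCX eqxx.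
rewrite rootE horner_sum (eq_bigr (fun=> 1)).
  by rewrite sumr_const card_ord pnatr_eq0.
by move=> i _; rewrite hornerXn expr1n.
Qed.

Lemma char_poly_conj_perm (R : comNzRingType) n (s : 'S_n) (A : 'M[R]_n) :
  char_poly ((perm_mx s)^T *m A *m perm_mx s) = char_poly A.
Proof.
rewrite /char_poly; set P : 'M[{poly R}]_n := perm_mx s.
have PtP : P^T *m P = 1%:M by rewrite tr_perm_mx -perm_mxM mulVg perm_mx1.
transitivity (\det (P^T *m char_poly_mx A *m P)).
  congr (\det _); rewrite /char_poly_mx mulmxBr mulmxBl.
  rewrite scalar_mxC -['X%:M *m _ *m _]mulmxA PtP mulmx1; congr (_ - _).
  by rewrite !map_mxM -map_trmx map_perm_mx.
by rewrite !det_mulmx mulrAC -det_mulmx PtP det1 mul1r.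
Qed.

(** * Cycle decomposition of a permutation matrix *)

Section CycleDecomposition.
Import tagnat.

(** One starting point [x i] is chosen on each orbit, of size [m i]; the index
with block [i] and offset [a] is sent to the [a]-th iterate of [s] at [x i].
This enumerates the indices so that [s] moves one step forward in a block and
wraps around at its end. *)
Lemma perm_cycle_decomposition n (s : 'S_n) :
  exists (t : nat) (m : 'I_t -> nat) (x : 'I_t -> 'I_n),
    [/\ forall i, (0 < m i)%N,
        forall i, iter (m i) s (x i) = x i &
        bijective (fun k : 'I_(\sum_i m i) => iter (sig2 k) s (x (sig1 k)))].
Proof.
pose O (i : 'I_#|porbits s|) : {set 'I_n} := enum_val i.
have /choice[x Ox] (i : 'I_#|porbits s|) : exists x, O i = porbit s x.
  by have /imsetP[x _] := enum_valP i; exists x.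
have card_gt0 i : (0 < #|porbit s (x i)|)%N.
  by rewrite lt0n card_porbit_neq0.
pose m i := #|porbit s (x i)|.
pose phi (k : 'I_(\sum_i m i)) := iter (sig2 k) s (x (sig1 k)).
exists #|porbits s|, m, x; rewrite -/phi.
split=> [i|i|]; [exact: card_gt0|exact: iter_porbit|].
have phi_inj : injective phi.
  move=> k l; rewrite -(sig2K k) -(sig2K l).
  move: (sig1 k) (sig1 l) (sig2 k) (sig2 l) => i j a b.
  rewrite /phi !Rank2K /= !Rank1K -!permX => eq_ab.
  have eq_ij : i = j.
    apply: enum_val_inj; rewrite -/(O i) -/(O j) !Ox.
    by rewrite -(porbit_perm s a) eq_ab porbit_perm.
  case: _ / eq_ij in b eq_ab *; congr Rank; apply/val_inj/eqP => /=.
  have lt_m (c : 'I_(m i)) : (c < #|porbit s (x i)|)%N := ltn_ord c.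
  rewrite -(nth_uniq (x i) _ _ (uniq_traject_porbit s (x i)));
    rewrite ?size_traject ?lt_m//.
  by rewrite !nth_traject ?lt_m// -!permX eq_ab.
have phi_surj y : exists k, phi k = y.
  have Oy : porbit s y \in porbits s by rewrite imset_f.
  pose i := enum_rank_in Oy (porbit s y).
  have : y \in porbit s (x i).
    by rewrite -Ox /O enum_rankK_in// porbit_id.
  rewrite porbit_traject => /trajectP[a lt_a ->].
  by exists (@Rank _ m i (Ordinal lt_a)); rewrite /phi Rank2K /= Rank1K.
have /choice[psi psiK] := phi_surj.
by exists psi => // k; apply: phi_inj.
Qed.

Lemma mxdiag_cycle_mxE (R : realType) t (m : 'I_t -> nat)
    (k l : 'I_(\sum_i m i)) :
  (\mxdiag_i cycle_mx R (m i)) k l =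
    ((sig1 k == sig1 l) && (sig2 l == (sig2 k).+1 %% m (sig1 k) :> nat)%N)%:R.
Proof.
rewrite mxE; move: (sig2 k) (sig2 l); case: eqVneq => [<-|_] a b.
  by rewrite conform_mx_id mxE.
by rewrite mxE.
Qed.

Lemma perm_mx_similar_cycles (R : realType) n (s : 'S_n) :
  exists (t : nat) (m : 'I_t -> nat) (sum_m : (\sum_(i < t) m i)%N = n),
    (forall i, (0 < m i)%N) /\
    perm_similar (perm_mx s : 'M[R]_n)
      (castmx (sum_m, sum_m) (\mxdiag_(i < t) cycle_mx R (m i))).
Proof.
have [t [m [x [m_gt0 iter_m phi_bij]]]] := perm_cycle_decomposition s.
have sum_m : (\sum_(i < t) m i)%N = n.
  by have := bij_eq_card phi_bij; rewrite !card_ord.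
exists t, m, sum_m; split=> //.
case: _ / sum_m in s x iter_m phi_bij *.
have phi_inj := bij_inj phi_bij.
pose phi := perm phi_inj.
exists (perm_mx phi^-1); first exact: perm_mx_is_perm.
rewrite castmx_id tr_perm_mx invgK -!perm_mxM; apply/matrixP => k l.
have lt_next : ((sig2 k).+1 %% m (sig1 k) < m (sig1 k))%N.
  by rewrite ltn_mod m_gt0.
have s_phi : s (phi k) = phi (Rank (sig1 k) (Ordinal lt_next)).
  rewrite !permE Rank2K /= Rank1K -iterS.
  have [last_k|] := eqVneq (sig2 k).+1 (m (sig1 k)).
    by rewrite last_k modnn iter_m.
  by move=> not_last; rewrite modn_small// ltn_neqAle not_last /= ltn_ord.
rewrite mxdiag_cycle_mxE !mxE !permM s_phi permK.
by rewrite -[l in RHS]sig2K -[in RHS]val_eqE eq_Rank [X in _ && X]eq_sym.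
Qed.

End CycleDecomposition.

Theorem theorem4p4 (R : realType) (n : nat) (A L : 'M[R]_n)
    (n_gt0 : (0 < n)%N)
    (stochA : stochastic_mx A)
    (unitA : A \in unitmx)
    (irrA : irreducible_mx A)
    (infA : infinite_set (root_exponents A))
    (limL : root_limits A L) :
  exists (t : nat) (m : 'I_t -> nat) (sum_m : (\sum_(i < t) m i)%N = n),
    [/\ forall i, (0 < m i)%N,
        t = mup 1 (char_poly L) &
        perm_similar L
          (castmx (sum_m, sum_m) (\mxdiag_(i < t) cycle_mx R (m i)))].
Proof.
have detL := root_limits_normdet_ge1 unitA limL.
have stochL : stochastic_mx L.
  by have [c [B [_ _ stochB _ cvgB]]] := limL; exact: cvg_stochastic stochB.
have /is_perm_mxP[s Ls] := stochastic_normdet_ge1_perm stochL detL.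
have [t [m [sum_m [m_gt0 simL]]]] := perm_mx_similar_cycles R s.
exists t, m, sum_m; rewrite Ls; split=> //.
have [P /is_perm_mxP[r ->] LP] := simL.
rewrite -(char_poly_conj_perm r) -LP char_poly_castmx char_poly_mxdiag.
have char_m i : char_poly (cycle_mx R (m i)) = 'X^((m i).-1.+1) - 1.
  by rewrite -char_poly_cycle_mx prednK.
rewrite mup_prod => [|i]; last exact/monic_neq0/char_poly_monic.
rewrite (eq_bigr (fun=> 1%N)) => [|i _]; last by rewrite char_m mup1_Xnsub1.
by rewrite sum1_card card_ord.
Qed.
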